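(* Let $n\ge 1$, $\hbar>0$, and let $\theta=(\theta^{ij})$ be a constant real antisymmetric $n\times n$ matrix. Let $\phi$ be a Schwartz function on $\mathbb{R}^n$ with Fourier transform $\tilde\phi(k)=\int d^nx\,e^{-ik\cdot x}\phi(x)$, and let $$f(x,p)=\int \frac{d^n w}{(\pi\hbar)^n}\frac{d^n k}{(2\pi)^n}\frac{d^n k'}{(2\pi)^n}\; e^{-\frac{2i}{\hbar}p\cdot w}\;\tilde{\phi}(k)\,\overline{\tilde{\phi}(k')}\;\Big(e^{ik\cdot(x+w)} *_{\theta} e^{-ik'\cdot(x-w)}\Big)$$ be the noncommutative Wigner distribution function of $\phi$. Then $f$ has twisted Galilean symmetry, in the following sense. (i) For $a\in\mathbb{R}^n$, if $\phi(x)$ is replaced by $\phi(x+a)$, then $f(x,p)$ is replaced by $f(x+a,p)$. (ii) For $p'\in\mathbb{R}^n$, if in the formula for $f$ the product $\tilde\phi(k)\overline{\tilde\phi(k')}$ is replaced by its twisted Galilean transform $$\tilde{\phi}\big(k-\tfrac{p'}{\hbar}\big)\,\overline{\tilde{\phi}\big(k'-\tfrac{p'}{\hbar}\big)}\;e^{\frac{i}{2\hbar}\sum_{i,j}\theta^{ij}p'_i(k_j-k'_j)},$$ then the resulting function $f'$ satisfies $f'(x,p)=f(x,p-p')$ for all $(x,p)$.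
   Context: Notation: $k\cdot x=\sum_i k_ix^i$; overline is complex conjugation. The product $*_\theta$ acts in the variable $x$ at fixed $w$: on exponentials, $e^{ik\cdot x}*_\theta e^{iq\cdot x}=e^{-\frac i2\sum_{i,j}\theta^{ij}k_iq_j}\,e^{i(k+q)\cdot x}$, extended bilinearly, so $$e^{ik\cdot(x+w)} *_{\theta} e^{-ik'\cdot(x-w)}=e^{\frac i2\sum_{i,j}\theta^{ij}k_ik'_j}\,e^{ik\cdot(x+w)}e^{-ik'\cdot(x-w)}.$$ The integrals over $k,k'$ are performed first, then the integral over $w$. Equivalently, $f(x,p)=(2\pi)^{-n}\int d^nw\,e^{ip\cdot w}\,\phi(x-\frac\hbar2w)*_\theta\overline\phi(x+\frac\hbar2w)$. *)

(* Defs.v *)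
From HB Require Import structures.
From mathcomp Require Import all_boot all_order all_algebra.
From mathcomp Require Import all_classical all_reals all_analysis.
From mathcomp Require Import complex ring.

Set Implicit Arguments.
Unset Strict Implicit.
Unset Printing Implicit Defensive.

Import Order.TTheory GRing.Theory Num.Theory.
Import numFieldNormedType.Exports.

Local Open Scope classical_set_scope.
Local Open Scope ring_scope.
Local Open Scope complex_scope.

Section sigma_finite_copy.
Context d (T : measurableType d) (R : realType).
Variables (mu : {measure set T -> \bar R}) (mu_fin : sigma_finite setT mu).

Let sigma_finite_copy_def & sigma_finite setT mu : set T -> \bar R := mu.
Local Notation copy := (sigma_finite_copy_def mu_fin).

HB.instance Definition _ := Measure.on copy.
HB.instance Definition _ := Measure_isSigmaFinite.Build _ _ _ copy mu_fin.

Definition sigma_finite_copy : {sigma_finite_measure set T -> \bar R} := copy.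
End sigma_finite_copy.

Section lebesgue_tuple.
Local Open Scope ereal_scope.

Let pushforward_product_sigma_finite_measure d1 d2 d3 (T1 : measurableType d1)
    (T2 : measurableType d2) (T3 : measurableType d3) (R : realType)
    (m1 : {sigma_finite_measure set T1 -> \bar R})
    (m2 : {sigma_finite_measure set T2 -> \bar R})
    (g : T1 * T2 -> T3) (h : T3 -> T1 * T2) :
  measurable_fun setT g -> measurable_fun setT h -> cancel g h ->
  exists mu : {sigma_finite_measure set T3 -> \bar R},
    mu = pushforward (m1 \x m2) g :> (set T3 -> \bar R).
Proof.
move=> mg mh gK.
pose P : {measure set (T1 * T2)%type -> \bar R} := m1 \x m2.
have /sigma_finiteP[F [TF ndF Foo]] := sigma_finiteT m1.
have /sigma_finiteP[G [TG ndG Goo]] := sigma_finiteT m2.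
have [Q QE] : exists Q : {measure set T3 -> \bar R},
    Q = pushforward P g :> (set T3 -> \bar R).
  by exists (measure_function_pushforward__canonical__measure_function_Measure
    P mg).
have Q_sigma_finite : sigma_finite setT Q.
  exists (fun k => h @^-1` (F k `*` G k)).
    apply/seteqP; split => // t _.
    have : [set: T1] (h t).1 by []; have : [set: T2] (h t).2 by [].
    rewrite TF TG => -[j _ Gj] [k _ Fk]; exists (maxn j k) => //; split.
    - by apply: (subsetPset _ _ (ndF _ _ (leq_maxr j k))).
    - by apply: (subsetPset _ _ (ndG _ _ (leq_maxl j k))).
  move=> k; have [mF Fk] := Foo k; have [mG Gk] := Goo k; split.
    by rewrite -[X in measurable X]setTI; apply: mh => //; exact: measurableX.
  rewrite QE /pushforward (_ : _ @^-1` _ = F k `*` G k).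
    rewrite (_ : P _ = m1 (F k) * m2 (G k)); last exact: product_measure1E.
    by rewrite lte_mul_pinfty// ge0_fin_numE.
  by apply/seteqP; split => z/=; rewrite gK.
by exists (sigma_finite_copy Q_sigma_finite).
Qed.

Variable R : realType.
Local Notation RT := (measurableTypeR R).

(* Lebesgue measure on R^n, as the n-fold product of the Lebesgue measure on R:
   the library has the measurable space n.-tuple R but no such measure on it. *)
Fixpoint lebesgue_tuple (n : nat) : set (n.-tuple RT) -> \bar R :=
  match n with
  | 0%N => \d_[tuple]
  | m.+1 => pushforward (@lebesgue_measure R \x @lebesgue_tuple m)
              (fun z : RT * m.-tuple RT => [the m.+1.-tuple RT of z.1 :: z.2])
  end.

Let measurable_consT m : measurable_fun [set: RT * m.-tuple RT]
  (fun z : RT * m.-tuple RT => [the m.+1.-tuple RT of z.1 :: z.2]).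
Proof. exact: measurable_cons. Qed.

Let measurable_unconsT m : measurable_fun [set: m.+1.-tuple RT]
  (fun t : m.+1.-tuple RT => (thead t, [tuple of behead t])).
Proof.
apply/measurable_fun_pairP; split.
- exact: measurable_tnth.
- exact: measurable_behead.
Qed.

Let lebesgue_tuple_spec n :
  exists mu : {sigma_finite_measure set (n.-tuple RT) -> \bar R},
    mu = @lebesgue_tuple n :> (set (n.-tuple RT) -> \bar R).
Proof.
elim: n => [|n [mu muE]]; first by exists \d_[tuple].
pose g (z : RT * n.-tuple RT) := [the n.+1.-tuple RT of z.1 :: z.2].
pose h (t : n.+1.-tuple RT) := (thead t, [tuple of behead t]).
have gK : cancel h g by move=> t; rewrite [RHS]tuple_eta; apply/val_inj.
have hK : cancel g h.
  by move=> [a t]; rewrite /h /g/=; congr pair; apply/val_inj.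
have [nu nuE] := @pushforward_product_sigma_finite_measure _ _ _ _ _ _ R
  (@lebesgue_measure R) mu g h (@measurable_consT n) (@measurable_unconsT n) hK.
by exists nu; rewrite nuE muE.
Qed.

Let lebesgue_tuple0 n : @lebesgue_tuple n set0 = 0.
Proof. by have [mu <-] := lebesgue_tuple_spec n; exact: measure0. Qed.

Let lebesgue_tuple_ge0 n A : 0 <= @lebesgue_tuple n A.
Proof. by have [mu <-] := lebesgue_tuple_spec n; exact: measure_ge0. Qed.

Let lebesgue_tuple_sigma_additive n : semi_sigma_additive (@lebesgue_tuple n).
Proof.
have [mu <-] := lebesgue_tuple_spec n.
exact: measure_semi_sigma_additive.
Qed.

HB.instance Definition _ n := isMeasure.Build _ _ _ (@lebesgue_tuple n)
  (@lebesgue_tuple0 n) (@lebesgue_tuple_ge0 n)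
  (@lebesgue_tuple_sigma_additive n).

Let lebesgue_tuple_sigma_finite n : sigma_finite setT (@lebesgue_tuple n).
Proof. by have [mu <-] := lebesgue_tuple_spec n; exact: sigma_finiteT. Qed.

HB.instance Definition _ n := Measure_isSigmaFinite.Build _ _ _
  (@lebesgue_tuple n) (@lebesgue_tuple_sigma_finite n).

Lemma lebesgue_tuple_box n (A : 'I_n -> set RT) :
  (forall i, measurable (A i)) ->
  lebesgue_tuple [set t : n.-tuple RT | forall i, A i (tnth t i)] =
  \prod_(i < n) lebesgue_measure (A i).
Proof.
elim: n A => [|n IHn] A mA.
  rewrite big_ord0 /= (_ : mkset _ = setT) ?diracT//.
  by apply/seteqP; split => // t _ [].
pose B := [set t : n.-tuple RT | forall i, A (lift ord0 i) (tnth t i)].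
have mB : measurable B.
  rewrite (_ : B = \bigcap_(i in [set: 'I_n])
      ((@tnth _ RT ^~ i) @^-1` A (lift ord0 i))).
    apply: fin_bigcap_measurable => // i _.
    by rewrite -[X in measurable X]setTI; exact: measurable_tnth.
  by apply/seteqP; split => t tB i; [move=> _|]; exact: tB.
rewrite big_ord_recl -IHn//= /pushforward.
rewrite (_ : _ @^-1` _ = A ord0 `*` B).
  exact: (product_measure1E (@lebesgue_measure R) (@lebesgue_tuple n)).
apply/seteqP; split => -[a t]/=.
- move=> tA; split => /=; first exact: (tA ord0).
  by move=> i; have := tA (lift ord0 i); rewrite tnthS.
- move=> [/= Aa Bt] i; have [j ->|->//] := unliftP ord0 i.
  by rewrite tnthS; exact: Bt.
Qed.

End lebesgue_tuple.

Section fourier_schwartz.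
Variables (R : realType) (n : nat).
Implicit Types (u phi : 'rV[R]_n -> R[i]) (k x : 'rV[R]_n).

Definition Cintegral u : R[i] :=
  (\int[@lebesgue_tuple R n]_t complex.Re (u (\row_i tnth t i))) +i*
  (\int[@lebesgue_tuple R n]_t complex.Im (u (\row_i tnth t i))).

Definition dotv k x : R := \sum_(i < n) k 0 i * x 0 i.

(* expi t is e^{i t} *)
Definition expi (t : R) : R[i] := cos t +i* sin t.

Definition fourier phi k : R[i] :=
  Cintegral (fun x => expi (- dotv k x) * phi x).

(* Complex-valued functions are differentiated componentwise, R[i] carrying no
   structure of normed R-module in the libraries. *)
Definition partial (i : 'I_n) u x : R[i] :=
  'D_(delta_mx 0 i) (fun y => complex.Re (u y)) x +i*
  'D_(delta_mx 0 i) (fun y => complex.Im (u y)) x.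

Definition C1 u :=
  let C1r (g : 'rV[R]_n -> R) :=
    continuous g /\ forall (i : 'I_n) x, derivable g x (delta_mx 0 i) in
  C1r (fun y => complex.Re (u y)) /\ C1r (fun y => complex.Im (u y)).

(* The list s runs through the iterated partial derivatives, in any order: all
   of them exist, are continuous, and are bounded after multiplication by any
   monomial. *)
Definition schwartz phi := forall s : seq 'I_n,
  let g := foldr partial phi s in
  C1 g /\
  forall alpha : 'I_n -> nat, exists M : R, forall x,
    `|(\prod_(i < n) x 0 i ^+ alpha i)%:C * g x| <= M%:C.

End fourier_schwartz.

Section moyal.
Variables (R : realType) (n : nat) (theta : 'M[R]_n).
Implicit Types (u v : 'rV[R]_n -> R[i]) (k q x w : 'rV[R]_n).

Definition theta_form k q : R :=
  \sum_(i < n) \sum_(j < n) theta i j * k 0 i * q 0 j.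

(* [:: (c_1, k_1); ...; (c_m, k_m)] stands for the trigonometric polynomial
   x |-> \sum_l c_l e^{i k_l.x} *)
Definition trigpoly := seq (R[i] * 'rV[R]_n).

Definition trig_eval (s : trigpoly) x : R[i] :=
  \sum_(ck <- s) ck.1 * expi (dotv ck.2 x).

Definition trig_mul (s t : trigpoly) : trigpoly :=
  [seq (ck.1 * dq.1 * expi (- (2^-1 * theta_form ck.2 dq.2)), ck.2 + dq.2)
    | ck <- s, dq <- t].

(* The product *_theta of functions on R^n that are trigonometric polynomials
   (a junk value otherwise): the bilinear extension of its value on
   exponentials. By moyalE it does not depend on the expansions chosen. *)
Definition moyal u v : 'rV[R]_n -> R[i] :=
  trig_eval (trig_mul (xget [::] [set s | trig_eval s = u])
                      (xget [::] [set t | trig_eval t = v])).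

Lemma expiD (a b : R) : expi (a + b) = expi a * expi b.
Proof.
by rewrite /expi cosD sinD; congr Complex; rewrite [LHS]addrC // addrC.
Qed.

Lemma dotvDl k q x : dotv (k + q) x = dotv k x + dotv q x.
Proof. by rewrite -big_split; apply: eq_bigr => i _; rewrite mxE mulrDl. Qed.

Lemma dotvDr k x w : dotv k (x + w) = dotv k x + dotv k w.
Proof. by rewrite -big_split; apply: eq_bigr => i _; rewrite mxE mulrDr. Qed.

Lemma dotvNl k x : dotv (- k) x = - dotv k x.
Proof. by rewrite -sumrN; apply: eq_bigr => i _; rewrite mxE mulNr. Qed.

Lemma dotvNr k x : dotv k (- x) = - dotv k x.
Proof. by rewrite -sumrN; apply: eq_bigr => i _; rewrite mxE mulrN. Qed.

Let transl q : 'rV[R]_n := \row_i (- (2^-1 * \sum_(j < n) theta i j * q 0 j)).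
Let transr k : 'rV[R]_n := \row_j (- (2^-1 * \sum_(i < n) theta i j * k 0 i)).

Let translE k q : - (2^-1 * theta_form k q) = dotv k (transl q).
Proof.
rewrite /theta_form mulr_sumr -sumrN; apply: eq_bigr => i _.
rewrite mxE mulrN mulrCA; congr (- (_ * _)); rewrite mulr_sumr.
by apply: eq_bigr => j _; ring.
Qed.

Let transrE k q : - (2^-1 * theta_form k q) = dotv q (transr k).
Proof.
rewrite /theta_form exchange_big mulr_sumr -sumrN; apply: eq_bigr => j _.
rewrite mxE mulrN mulrCA; congr (- (_ * _)); rewrite mulr_sumr.
by apply: eq_bigr => i _; ring.
Qed.

Let trig_mulEl s t x : trig_eval (trig_mul s t) x =
  \sum_(dq <- t) dq.1 * expi (dotv dq.2 x) * trig_eval s (x + transl dq.2).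
Proof.
rewrite /trig_eval big_allpairs_dep exchange_big; apply: eq_bigr => -[d q] _ /=.
rewrite mulr_sumr; apply: eq_bigr => -[c k] _ /=.
by rewrite translE dotvDl dotvDr !expiD; ring.
Qed.

Let trig_mulEr s t x : trig_eval (trig_mul s t) x =
  \sum_(ck <- s) ck.1 * expi (dotv ck.2 x) * trig_eval t (x + transr ck.2).
Proof.
rewrite /trig_eval big_allpairs_dep; apply: eq_bigr => -[c k] _ /=.
rewrite mulr_sumr; apply: eq_bigr => -[d q] _ /=.
by rewrite transrE dotvDl dotvDr !expiD; ring.
Qed.

Lemma moyalE s t :
  moyal (trig_eval s) (trig_eval t) = trig_eval (trig_mul s t).
Proof.
rewrite /moyal; case: xgetP => [s' _ /= s'E|/(_ s) []//].
case: xgetP => [t' _ /= t'E|/(_ t) []//].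
apply/funext => x; rewrite trig_mulEl s'E -trig_mulEl trig_mulEr t'E.
by rewrite -trig_mulEr.
Qed.

Lemma moyal_expi k q :
  moyal (fun x => expi (dotv k x)) (fun x => expi (dotv q x)) =
  fun x => expi (- (2^-1 * theta_form k q)) * expi (dotv (k + q) x).
Proof.
have expiE k' : (fun x => expi (dotv k' x)) = trig_eval [:: (1, k')].
  by apply/funext => x; rewrite /trig_eval big_seq1 mul1r.
by rewrite !expiE moyalE; apply/funext => x; rewrite /trig_eval big_seq1 !mul1r.
Qed.

Lemma moyal_expi_translate k q x w :
  moyal (fun y => expi (dotv k (y + w))) (fun y => expi (- dotv q (y - w))) x =
  expi (2^-1 * theta_form k q) *
  (expi (dotv k (x + w)) * expi (- dotv q (x - w))).
Proof.
have -> : (fun y => expi (dotv k (y + w))) =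
          trig_eval [:: (expi (dotv k w), k)].
  by apply/funext => y; rewrite /trig_eval big_seq1/= dotvDr expiD mulrC.
have -> : (fun y => expi (- dotv q (y - w))) =
          trig_eval [:: (expi (dotv q w), - q)].
  apply/funext => y; rewrite /trig_eval big_seq1/= dotvNl dotvDr dotvNr.
  by rewrite opprD opprK expiD mulrC.
have thetaN : theta_form k (- q) = - theta_form k q.
  rewrite -sumrN; apply: eq_bigr => i _; rewrite -sumrN; apply: eq_bigr => j _.
  by rewrite mxE mulrN.
rewrite moyalE /trig_eval big_seq1/= thetaN mulrN opprK.
by rewrite dotvDl dotvNl !dotvDr dotvNr !opprD opprK !expiD; ring.
Qed.

End moyal.

Section ncwigner.
Variables (R : realType) (n : nat) (hbar : R) (theta : 'M[R]_n).
Implicit Types (phi : 'rV[R]_n -> R[i]) (x p : 'rV[R]_n).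

(* The Wigner integral with an arbitrary amplitude A k k' in place of
   fourier phi k * (fourier phi k')^*; k and k' are integrated first. *)
Definition ncwigner_integral (A : 'rV[R]_n -> 'rV[R]_n -> R[i]) x p : R[i] :=
  Cintegral (fun w => ((pi * hbar) ^- n)%:C *
  Cintegral (fun k => ((2 * pi) ^- n)%:C *
  Cintegral (fun k' => ((2 * pi) ^- n)%:C *
    (expi (- (2 / hbar * dotv p w)) * A k k' *
     moyal theta (fun y => expi (dotv k (y + w)))
                 (fun y => expi (- dotv k' (y - w))) x)))).

Definition wigner_amplitude phi (k k' : 'rV[R]_n) : R[i] :=
  fourier phi k * (fourier phi k')^*.

Definition ncwigner phi := ncwigner_integral (wigner_amplitude phi).

Definition twisted_galilean p' (A : 'rV[R]_n -> 'rV[R]_n -> R[i])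
    (k k' : 'rV[R]_n) : R[i] :=
  A (k - hbar^-1 *: p') (k' - hbar^-1 *: p') *
  expi ((2 * hbar)^-1 *
    \sum_(i < n) \sum_(j < n) theta i j * p' 0 i * (k 0 j - k' 0 j)).

End ncwigner.

(* Main.v *)
(* Translating phi by a multiplies its Fourier transform by e^{ik.a}; the phases
   of k and k' are those that the exponentials e^{ik.x} and e^{-ik'.x} pick up
   when x is moved to x + a.  For the boost, substitute k + p'/hbar for k and
   k' + p'/hbar for k': by antisymmetry of theta the phase of the twist cancels
   the cross terms of the Moyal phase, and what remains is e^{2i p'.w/hbar}.

   The substitution is made under integrals of functions not known to be
   measurable, so translation invariance is proved for the integral of an
   arbitrary function.  Scaling by a phase mixes real and imaginary parts, which
   is where integrability, hence the decay of phi, is needed. *)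

From HB Require Import structures.
Require Import Defs.
From mathcomp Require Import all_boot all_order all_algebra.
From mathcomp Require Import all_classical all_reals all_analysis.
From mathcomp Require Import measurable_realfun.
From mathcomp Require Import complex ring.

Set Implicit Arguments.
Unset Strict Implicit.
Unset Printing Implicit Defensive.

Import Order.TTheory GRing.Theory Num.Theory.
Import numFieldNormedType.Exports.
Local Open Scope classical_set_scope.
Local Open Scope ring_scope.
Local Open Scope complex_scope.

(** * Change of variables along measure-preserving bijections *)

Section measure_preserving.
Local Open Scope ereal_scope.
Import HBNNSimple.
Context d (T : measurableType d) (R : realType).
Variable mu : {measure set T -> \bar R}.

(* The integral of f is lower f^\+ - lower f^\-; this supremum over simple
   functions below f makes sense for non-measurable f as well. *)
Let lower (f : T -> \bar R) : \bar R := ereal_sup [set sintegral mu h |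
  h in [set h : {nnsfun T >-> R} | forall x, (h x)%:E <= f x]].

(** If [h] is simple and lies below [f], then [h \o s] is simple and lies below [f \o s]. Its
    integral is that of [h], because the level sets keep their measure. *)
Let le_lower_comp (s : T -> T) f :
  measurable_fun setT s ->
  (forall A, measurable A -> mu (s @^-1` A) = mu A) ->
  lower f <= lower (f \o s).
Proof.
move=> ms smu; apply: ge_ereal_sup => _ [h hf <-].
have fin_hs : finite_set (range (h \o s)).
  by apply: sub_finite_set (@fimfunP _ _ h) => _ [x _ <-]; exists (s x).
pose hs : {nnsfun T >-> R} := HB.pack (h \o s)
  (isMeasurableFun.Build _ _ _ _ (h \o s)
    (measurableT_comp (measurable_funPT h) ms))
  (FiniteImage.Build _ _ (h \o s) fin_hs)
  (isNonNegFun.Build _ _ (h \o s) (fun x => @fun_ge0 _ _ h (s x))).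
apply: ereal_sup_ubound; exists hs => [x|]; first exact: hf.
rewrite !sintegralET; apply: eq_fsbigr => r _; congr (_ * _).
exact: smu.
Qed.

(** The inverse [t] preserves the measure too, so [le_lower_comp] for [s] and for [t] gives the two
    inequalities. They are applied to the positive and negative parts of [f]. *)
Lemma integral_comp_measure_preserving (s t : T -> T) (f : T -> \bar R) :
  cancel s t -> cancel t s -> measurable_fun setT s -> measurable_fun setT t ->
  (forall A, measurable A -> mu (s @^-1` A) = mu A) ->
  \int[mu]_x f (s x) = \int[mu]_x f x.
Proof.
move=> st ts ms mt smu.
have tmu A : measurable A -> mu (t @^-1` A) = mu A.
  move=> mA; rewrite -smu; last by rewrite -[X in measurable X]setTI; exact: mt.
  by congr (mu _); apply/seteqP; split=> x /=; rewrite st.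
have lowerE g : lower (g \o s) = lower g.
  apply/eqP; rewrite eq_le le_lower_comp// andbT.
  have {2}-> : g = (g \o s) \o t by apply/funext => x /=; rewrite ts.
  exact: le_lower_comp.
rewrite /integral !patch_setT.
congr (_ - _).
  by rewrite (funepos_comp f s); exact: lowerE.
by rewrite (funeneg_comp f s); exact: lowerE.
Qed.

End measure_preserving.

(** * Translation invariance of Lebesgue measure on R and on R^n *)

Section lebesgue_translation.
Variable R : realType.
Local Notation RT := (measurableTypeR R).
Local Open Scope ereal_scope.

(** The pushforward of Lebesgue measure under translation gives half-open intervals their length,
    and this determines the measure. *)
Lemma lebesgue_measure_translate (a : R) (A : set RT) : measurable A ->
  lebesgue_measure ((fun x : RT => x + a : RT)%R @^-1` A) = lebesgue_measure A.
Proof.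
have ms : measurable_fun [set: RT] (fun x : RT => x + a : RT)%R.
  by apply: measurable_funD => //; exact: measurable_id.
pose nu : {measure set RT -> \bar R} :=
  measure_function_pushforward__canonical__measure_function_Measure
    (@lebesgue_measure R) ms.
move=> mA; apply/esym.
apply: (lebesgue_measure_unique (mu := nu)) => // _ [[x y] _ <-].
rewrite [RHS](_ : _ = lebesgue_measure [set` `]x - a, y - a]]%R).
  rewrite !lebesgue_measure_itv/= !lte_fin ltrD2r -!EFinB.
  by rewrite opprB addrA subrK.
congr lebesgue_measure; apply/seteqP; split=> z /=;
  by rewrite !in_itv/= ltrBlDr lerBrDr.
Qed.

Definition tuple_translate n (a : 'rV[R]_n) (t : n.-tuple RT) : n.-tuple RT :=
  [tuple tnth t i + a 0 i | i < n]%R.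

Lemma tuple_translateK n (a : 'rV[R]_n) :
  cancel (tuple_translate a) (tuple_translate (- a)).
Proof.
by move=> t; apply: eq_from_tnth => i; rewrite !tnth_mktuple mxE addrK.
Qed.

Lemma measurable_tuple_translate n (a : 'rV[R]_n) :
  measurable_fun setT (tuple_translate a).
Proof.
apply/measurable_fun_tnthP => i.
rewrite (_ : _ \o _ = fun t => tnth t i + a 0 i)%R; last first.
  by apply/funext => t /=; rewrite tnth_mktuple.
by apply: measurable_funD => //; exact: measurable_tnth.
Qed.

(** Induction on n: the section at x of the preimage of A is a translate of the section of A at x +
    a_0. The induction hypothesis removes the shift of the tail, and invariance of the integral over
    the head removes a_0. *)
Lemma lebesgue_tuple_translate n (a : 'rV[R]_n) A : measurable A ->
  lebesgue_tuple (tuple_translate a @^-1` A) = @lebesgue_tuple R n A.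
Proof.
elim: n a A => [|n IHn] a A mA.
  rewrite (_ : _ @^-1` _ = A)//; apply/seteqP.
  by split => t /=; rewrite [tuple_translate a t]tuple0 [t]tuple0.
pose c (z : RT * n.-tuple RT) := [the n.+1.-tuple RT of z.1 :: z.2].
have mc : measurable_fun setT c by exact: measurable_cons.
have mcA : measurable (c @^-1` A).
  by rewrite -[X in measurable X]setTI; exact: mc.
pose a' : 'rV[R]_n := \row_i a 0%R (lift ord0 i).
rewrite /= /pushforward /product_measure1 /=.
pose f (x : RT) := lebesgue_tuple (xsection (c @^-1` A) x).
transitivity (\int[lebesgue_measure]_x f (x + a 0 ord0)%R); last first.
  apply: (@integral_comp_measure_preserving _ RT R lebesgue_measure
    (fun x => x + a 0 ord0)%R (fun x => x - a 0 ord0)%R).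
  - by move=> x; rewrite addrK.
  - by move=> x; rewrite subrK.
  - by apply: measurable_funD => //; exact: measurable_id.
  - by apply: measurable_funB => //; exact: measurable_id.
  - exact: lebesgue_measure_translate.
apply: eq_integral => x _; rewrite /f.
rewrite -(IHn a' (xsection (c @^-1` A) (x + a 0 ord0)%R)); last first.
  exact: measurable_xsection.
congr (lebesgue_tuple _); rewrite !xsectionE.
apply/seteqP; split => t; rewrite /preimage/=;
  rewrite (_ : tuple_translate _ _ = c (x + a 0 ord0, tuple_translate a' t)%R) //;
  apply: eq_from_tnth => i; rewrite tnth_mktuple;
  (have [j ->|->] := unliftP ord0 i; last by []);
  by rewrite !tnthS tnth_mktuple mxE.
Qed.

End lebesgue_translation.

(** * Translation of complex integrals *)

Section Cintegral.
Context (R : realType) (n : nat).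
Implicit Types (u v : 'rV[R]_n -> R[i]) (a : 'rV[R]_n).

Lemma eq_Cintegral u v : u =1 v -> Cintegral u = Cintegral v.
Proof. by move=> /funext ->. Qed.

(** The extended real integrals already agree before [fine] is taken, so the equality also covers
    integrals that diverge. *)
Lemma Cintegral_translate u a : Cintegral (fun x => u (x + a)) = Cintegral u.
Proof.
have E (f : n.-tuple (measurableTypeR R) -> R) :
    \int[@lebesgue_tuple R n]_t f (tuple_translate a t) =
    \int[@lebesgue_tuple R n]_t f t.
  congr fine.
  apply: (@integral_comp_measure_preserving _ _ _ (@lebesgue_tuple R n)
    (tuple_translate a) (tuple_translate (- a)) (EFin \o f)).
  - exact: tuple_translateK.
  - by rewrite -{2}[a]opprK; exact: tuple_translateK.
  - exact: measurable_tuple_translate.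
  - exact: measurable_tuple_translate.
  - exact: lebesgue_tuple_translate.
have tE t : \row_i tnth t i + a = \row_i tnth (tuple_translate a t) i.
  by apply/rowP => i; rewrite !mxE tnth_mktuple.
rewrite /Cintegral; congr Complex.
  by rewrite -[RHS]E; apply: eq_Rintegral => t _; rewrite tE.
by rewrite -[RHS]E; apply: eq_Rintegral => t _; rewrite tE.
Qed.

End Cintegral.

(** * Measurability of continuous functions on R^n *)

Section measurability.
Context (R : realType) (n : nat).
Local Notation RT := (measurableTypeR R).

Lemma open_measurable_tuple (U : set 'rV[R]_n) : open U ->
  measurable [set t : n.-tuple RT | U (\row_i tnth t i)].
Proof.
move=> oU.
(* U is the union of the rational boxes r z m that it contains. *)
pose r (z : {ffun 'I_n -> rat}) (m : nat) :=
  [set t : n.-tuple RT | forall i, `|ratr (z i) - tnth t i| < m.+1%:R^-1].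
pose good (z : {ffun 'I_n -> rat}) (m : nat) :=
  r z m `<=` [set t : n.-tuple RT | U (\row_i tnth t i)].
rewrite (_ : mkset _ = \bigcup_zm [set t | good zm.1 zm.2 /\ r zm.1 zm.2 t]).
  apply: countable_bigcupT_measurable => [|[z m] /=]; first exact: countableP.
  have [gzm|ngzm] := pselect (good z m); last first.
    by rewrite (_ : mkset _ = set0)//; apply/seteqP; split => // t [].
  rewrite (_ : mkset _ = \bigcap_(i in [set: 'I_n]) ((@tnth _ RT ^~ i) @^-1`
    (ball (ratr (z i) : R) m.+1%:R^-1))).
    apply: fin_bigcap_measurable => // i _.
    rewrite -[X in measurable X]setTI; apply: measurable_tnth => //.
    exact: measurable_ball.
  apply/seteqP; split => t /=; first by move=> [_ tB] i _; exact: tB.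
  by move=> tB; split => // i; exact: tB.
apply/seteqP; split => [t /= Ut|t [[z m] _] /= [zm]]; last exact: zm.
have /nbhs_ballP[e/= e0 eU] : nbhs (\row_i tnth t i : 'rV[R]_n) U.
  by apply: open_nbhs_nbhs; split.
(* A box of radius below e / 2 around a rational point that is itself within e / 2 of t in each
   coordinate stays in the e-ball around t, hence in U. *)
have [m me] : exists m, m.+1%:R^-1 < e / 2.
  have [m] := @ltr_add_invr R 0 (e / 2) (divr_gt0 e0 (ltr0n _ 2)).
  by rewrite add0r; exists m.
have zP i : exists q : rat, `|ratr q - tnth t i| < m.+1%:R^-1.
  have [|q] := @rat_in_itvoo R (tnth t i - m.+1%:R^-1) (tnth t i + m.+1%:R^-1).
    by rewrite ltrBlDr -addrA ltrDl addr_gt0// invr_gt0.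
  by rewrite in_itv/= -ltr_distl => ?; exists q.
have [z zt] := choice zP.
exists ([ffun i => z i], m) => //=; split; last first.
  by move=> i; rewrite ffunE; exact: zt.
move=> s sz; apply: eU; split => // i j; rewrite !mxE.
rewrite /ball/= (splitr e) -(subrKA (ratr (z j))).
rewrite (le_lt_trans (ler_normD _ _))// ltrD//; apply: lt_trans me.
  by rewrite distrC.
by have := sz j; rewrite ffunE.
Qed.

Lemma measurable_continuous_tuple (g : 'rV[R]_n -> R) : continuous g ->
  measurable_fun setT (fun t : n.-tuple RT => g (\row_i tnth t i)).
Proof.
move=> /continuousP cg; apply: (measurability _ (RGenOpens.measurableE R)).
move=> _ [_ [a [b ->] <-]]; rewrite setTI.
by have /cg/open_measurable_tuple : open `]a, b[%classic by exact: interval_open.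
Qed.

End measurability.

(** * An integrable weight on R^n *)

Section integrability.
Variable R : realType.
Local Notation RT := (measurableTypeR R).
Local Open Scope ereal_scope.

(** By evenness this is twice the arctangent integral over the half-line. *)
Lemma integral_oneDsqrV_lty :
  \int[@lebesgue_measure R]_x ((oneDsqr x)^-1)%:E < +oo.
Proof.
rewrite ge0_symfun_integralT.
- rewrite -set_itvcy integral0y_oneDsqr -EFinM; exact: ltry.
- by move=> x; rewrite invr_ge0 ltW// oneDsqr_gt0.
- exact: continuous_oneDsqrV.
- by move=> x; rewrite /= /oneDsqr sqrrN.
Qed.

(** A product over the coordinates, not a power of a norm, so that its integral factors into
    one-dimensional ones. *)
Definition decay_weight n (t : n.-tuple RT) : R :=
  \prod_(i < n) (oneDsqr (tnth t i))^-1.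

Lemma decay_weight_ge0 n (t : n.-tuple RT) : (0 <= decay_weight t)%R.
Proof. by apply: prodr_ge0 => i _; rewrite invr_ge0 ltW// oneDsqr_gt0. Qed.

Lemma measurable_decay_weight n : measurable_fun setT (@decay_weight n).
Proof.
apply: measurable_prod => i _.
apply: (@measurableT_comp _ _ _ _ _ _ (fun x : R => (oneDsqr x)^-1)%R); last first.
  exact: measurable_tnth.
exact: continuous_measurable_fun (@continuous_oneDsqrV R).
Qed.

(** Induction on n: Tonelli splits off the factor of the first coordinate and leaves the weight of
    the tail, both with finite integral. *)
Lemma integral_decay_weight_lty n :
  \int[@lebesgue_tuple R n]_t (decay_weight t)%:E < +oo.
Proof.
elim: n => [|n IHn].
  rewrite /= (_ : (fun t => _) = cst 1); last first.
    by apply/funext => t; rewrite /decay_weight big_ord0.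
  by rewrite integral_cst//= mul1e diracT ltry.
pose c (z : RT * n.-tuple RT) := [the n.+1.-tuple RT of z.1 :: z.2].
have mc : measurable_fun setT c by exact: measurable_cons.
have -> : \int[@lebesgue_tuple R n.+1]_t (decay_weight t)%:E =
    \int[pushforward (@lebesgue_measure R \x @lebesgue_tuple R n) c]_t
      (decay_weight t)%:E.
  by [].
rewrite (ge0_integral_pushforward mc)//; last 2 first.
- by apply/measurable_EFinP; exact: measurable_decay_weight.
- by move=> t _; rewrite lee_fin decay_weight_ge0.
rewrite preimage_setT.
rewrite fubini_tonelli1; last 2 first.
- apply: measurableT_comp => //; apply/measurable_EFinP.
  exact: measurable_decay_weight.
- by move=> z /=; rewrite lee_fin decay_weight_ge0.
have decay_weight_cons x t :
    decay_weight (c (x, t)) = ((oneDsqr x)^-1 * decay_weight t)%R.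
  rewrite /decay_weight big_ord_recl; congr (_ * _)%R.
  by apply: eq_bigr => i _; rewrite tnthS.
pose I := \int[@lebesgue_tuple R n]_t (decay_weight t)%:E.
have -> : \int[@lebesgue_measure R]_x fubini_F (@lebesgue_tuple R n)
    ((fun t => (decay_weight t)%:E) \o c) x =
    \int[@lebesgue_measure R]_x (((oneDsqr x)^-1)%:E * I).
  apply: eq_integral => x _; rewrite /fubini_F /= -ge0_integralZl//=.
  - by apply: eq_integral => t _; rewrite decay_weight_cons EFinM.
  - by apply/measurable_EFinP; exact: measurable_decay_weight.
  - by move=> t _; rewrite lee_fin decay_weight_ge0.
rewrite ge0_integralZr//=.
- apply: lte_mul_pinfty => //.
  + by apply: integral_ge0 => x _; rewrite lee_fin invr_ge0 ltW// oneDsqr_gt0.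
  + rewrite ge0_fin_numE; first exact: integral_oneDsqrV_lty.
    by apply: integral_ge0 => x _; rewrite lee_fin invr_ge0 ltW// oneDsqr_gt0.
- apply/measurable_EFinP.
  exact: continuous_measurable_fun (@continuous_oneDsqrV R).
- by apply: integral_ge0 => t _; rewrite lee_fin decay_weight_ge0.
Qed.

Lemma integrable_decay_weight n :
  (@lebesgue_tuple R n).-integrable setT (fun t => (decay_weight t)%:E).
Proof.
apply/integrableP; split.
  by apply/measurable_EFinP; exact: measurable_decay_weight.
under eq_integral do rewrite gee0_abs ?lee_fin ?decay_weight_ge0//.
exact: integral_decay_weight_lty.
Qed.

End integrability.

(** * Complex scalars and integrals of decaying functions *)

Section complex_integral.
Context (R : realType) (n : nat).
Implicit Types (u phi : 'rV[R]_n -> R[i]) (g : 'rV[R]_n -> R).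

Definition integrable_on_tuple g :=
  (@lebesgue_tuple R n).-integrable setT (fun t => (g (\row_i tnth t i))%:E).

Lemma Cintegral_scale (c : R[i]) u :
  integrable_on_tuple (fun x => complex.Re (u x)) ->
  integrable_on_tuple (fun x => complex.Im (u x)) ->
  Cintegral (fun x => c * u x) = c * Cintegral u.
Proof.
case: c => a b iRe iIm; rewrite /Cintegral.
have ReE t : complex.Re ((a +i* b) * u (\row_i tnth t i)) =
    a * complex.Re (u (\row_i tnth t i)) - b * complex.Im (u (\row_i tnth t i)).
  by case: (u _).
have ImE t : complex.Im ((a +i* b) * u (\row_i tnth t i)) =
    a * complex.Im (u (\row_i tnth t i)) + b * complex.Re (u (\row_i tnth t i)).
  by case: (u _) => x y /=.
congr Complex.
- under eq_Rintegral do rewrite ReE.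
  rewrite RintegralB//.
  + by rewrite !RintegralZl.
  + exact: (integrableZl measurableT a iRe).
  + exact: (integrableZl measurableT b iIm).
- under eq_Rintegral do rewrite ImE.
  rewrite RintegralD//.
  + by rewrite !RintegralZl.
  + exact: (integrableZl measurableT a iIm).
  + exact: (integrableZl measurableT b iRe).
Qed.

(** The product of the 1 + x_i^2 expands into monomials x^(2f), with f running through the
    indicators of sets of coordinates. The Schwartz condition without derivatives bounds each of
    them, and M is the sum of the bounds. *)
Lemma schwartz_decay phi : schwartz phi -> exists M : R, forall x,
  `|phi x| * (\prod_(i < n) oneDsqr (x 0 i))%:C <= M%:C.
Proof.
move=> /(_ [::])[_ /=] decay.
have [M phiM] := choice
  (fun f : {ffun 'I_n -> bool} => decay (fun i => 2 * f i)%N).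
exists (\sum_f M f) => x.
have -> : \prod_(i < n) oneDsqr (x 0 i) =
    \sum_(f : {ffun 'I_n -> bool}) \prod_(i < n) x 0 i ^+ (2 * f i).
  rewrite -(bigA_distr_bigA (fun i (b : bool) => x 0 i ^+ (2 * b))).
  by apply: eq_bigr => i _; rewrite big_bool /= muln1 muln0 expr0 addrC.
rewrite !rmorph_sum mulr_sumr ler_sum// => f _.
apply: le_trans (phiM f x); rewrite normrM mulrC ler_wpM2r//.
by rewrite real_ler_norm// complex_real eqxx.
Qed.

(** Comparison with M times [decay_weight]; continuity supplies the measurability. *)
Lemma integrable_decay g (M : R) : continuous g ->
  (forall x, `|g x| * \prod_(i < n) oneDsqr (x 0 i) <= M) ->
  integrable_on_tuple g.
Proof.
move=> cg gM.
apply: (@le_integrable _ _ _ _ _ _ _ (fun t => (M * decay_weight t)%:E)) => //.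
- by apply/measurable_EFinP; exact: measurable_continuous_tuple.
- move=> t _; rewrite /= lee_fin; apply: le_trans (ler_norm _).
  have := gM (\row_i tnth t i).
  rewrite (eq_bigr (fun i => oneDsqr (tnth t i))) => [|i _]; last by rewrite mxE.
  rewrite /decay_weight prodfV ler_pdivlMr ?prodr_gt0//.
- exact: (integrableZl measurableT M (integrable_decay_weight R n)).
Qed.

Lemma Cintegral_scale_decay (c : R[i]) u (M : R) :
  continuous (fun x => complex.Re (u x)) ->
  continuous (fun x => complex.Im (u x)) ->
  (forall x, `|u x| * (\prod_(i < n) oneDsqr (x 0 i))%:C <= M%:C) ->
  Cintegral (fun x => c * u x) = c * Cintegral u.
Proof.
move=> cRe cIm uM.
(* The bound is restated in R, where dropping one of the two squares bounds the real or the
   imaginary part by the modulus. *)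
have {}uM x : Num.sqrt (complex.Re (u x) ^+ 2 + complex.Im (u x) ^+ 2) *
    \prod_(i < n) oneDsqr (x 0 i) <= M.
  by have := uM x; rewrite normc_def -rmorphM lecR.
have P0 x : 0 <= \prod_(i < n) oneDsqr (x 0 i : R).
  by apply: prodr_ge0 => i _; rewrite ltW// oneDsqr_gt0.
apply: Cintegral_scale; apply: (integrable_decay (M := M)) => // x;
  apply: le_trans (uM x); rewrite ler_wpM2r// -sqrtr_sqr ler_wsqrtr//.
  by rewrite lerDl sqr_ge0.
by rewrite lerDr sqr_ge0.
Qed.

End complex_integral.

(** * The form of theta and the phases of the Moyal product *)

Section theta.
Context (R : realType) (n : nat) (theta : 'M[R]_n).
Implicit Types k q : 'rV[R]_n.

Lemma theta_formDl k k' q :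
  theta_form theta (k + k') q = theta_form theta k q + theta_form theta k' q.
Proof.
rewrite /theta_form -big_split; apply: eq_bigr => i _.
by rewrite -big_split; apply: eq_bigr => j _; rewrite mxE /=; ring.
Qed.

Lemma theta_formDr k q q' :
  theta_form theta k (q + q') = theta_form theta k q + theta_form theta k q'.
Proof.
rewrite /theta_form -big_split; apply: eq_bigr => i _.
by rewrite -big_split; apply: eq_bigr => j _; rewrite mxE /=; ring.
Qed.

Lemma theta_formZl (c : R) k q :
  theta_form theta (c *: k) q = c * theta_form theta k q.
Proof.
rewrite /theta_form mulr_sumr; apply: eq_bigr => i _.
by rewrite mulr_sumr; apply: eq_bigr => j _; rewrite mxE; ring.
Qed.

Lemma theta_formNr k q : theta_form theta k (- q) = - theta_form theta k q.
Proof.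
rewrite /theta_form -sumrN; apply: eq_bigr => i _.
by rewrite -sumrN; apply: eq_bigr => j _; rewrite mxE; ring.
Qed.

Lemma theta_form_antisym k q : theta^T = - theta ->
  theta_form theta k q = - theta_form theta q k.
Proof.
move=> thetaT; rewrite /theta_form exchange_big -sumrN; apply: eq_bigr => i _.
rewrite -sumrN; apply: eq_bigr => j _.
have -> : theta j i = - theta i j.
  by move: (congr1 (fun M : 'M[R]_n => M i j) thetaT); rewrite !mxE.
by ring.
Qed.

Lemma theta_form_diag k : theta^T = - theta -> theta_form theta k k = 0.
Proof.
by move=> /(theta_form_antisym k k) /eqP; rewrite -addr_eq0 -mulr2n mulrn_eq0
  => /eqP.
Qed.

End theta.

Lemma dotvZl (R : realType) (n : nat) (c : R) (k x : 'rV[R]_n) :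
  dotv (c *: k) x = c * dotv k x.
Proof.
by rewrite /dotv mulr_sumr; apply: eq_bigr => i _; rewrite mxE mulrA.
Qed.

Lemma conjc_expi (R : realType) (t : R) : ((expi t)^*)%R = expi (- t).
Proof. by rewrite /expi cosN sinN. Qed.

(** The Moyal phase does not involve x, so only the plain exponentials react to the shift, with
    total phase e^{i(k-k').a}. *)
Lemma moyal_expi_shift (R : realType) (n : nat) (theta : 'M[R]_n)
    (k k' a x w : 'rV[R]_n) :
  expi (dotv k a) * (expi (dotv k' a))^* *
    moyal theta (fun y => expi (dotv k (y + w)))
                (fun y => expi (- dotv k' (y - w))) x =
  moyal theta (fun y => expi (dotv k (y + w)))
              (fun y => expi (- dotv k' (y - w))) (x + a).
Proof.
rewrite conjc_expi !moyal_expi_translate -!expiD; congr expi.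
by rewrite !dotvDr !dotvNr; ring.
Qed.

Lemma moyal_expi_boost (R : realType) (n : nat) (theta : 'M[R]_n)
    (hbar : R) (k k' p' p x w : 'rV[R]_n) :
  hbar != 0 -> theta^T = - theta ->
  let q := hbar^-1 *: p' in
  expi (- (2 / hbar * dotv p w)) *
  expi ((2 * hbar)^-1 *
    \sum_(i < n) \sum_(j < n)
      theta i j * p' 0 i * ((k + q) 0 j - (k' + q) 0 j)) *
  moyal theta (fun y => expi (dotv (k + q) (y + w)))
              (fun y => expi (- dotv (k' + q) (y - w))) x =
  expi (- (2 / hbar * dotv (p - p') w)) *
  moyal theta (fun y => expi (dotv k (y + w)))
              (fun y => expi (- dotv k' (y - w))) x.
Proof.
move=> hbar0 thetaT q.
(* The shifts by [q] cancel in the difference, so the twist is the form at p' and k - k'. *)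
have -> : \sum_(i < n) \sum_(j < n)
    theta i j * p' 0 i * ((k + q) 0 j - (k' + q) 0 j) =
    theta_form theta p' k - theta_form theta p' k'.
  rewrite -theta_formNr -theta_formDr.
  by apply: eq_bigr => i _; apply: eq_bigr => j _; rewrite !mxE; ring.
rewrite !moyal_expi_translate -!expiD; congr expi.
(* The form at (k + q, k' + q) has the cross terms theta(k, q) + theta(q, k') = theta(q, k' - k),
   and half of this is minus the twist. The plain exponentials contribute q.(x + w) - q.(x - w) = 2
   q.w, which turns p into p - p'. *)
rewrite !theta_formDl !theta_formDr theta_form_diag//.
rewrite (theta_form_antisym k q)// !dotvDl dotvNl !dotvDr !dotvNr !dotvZl.
by rewrite !theta_formZl; field; rewrite hbar0.
Qed.

(** * The Fourier transform of a translate *)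

Section fourier_translation.
Context (R : realType) (n : nat).
Implicit Types (phi : 'rV[R]_n -> R[i]) (k a : 'rV[R]_n).

Lemma continuous_dotv k : continuous (dotv k).
Proof.
apply: continuous_big => [|i _ x]; first exact: add_continuous.
apply: continuousM; first exact: cst_continuous.
exact: coord_continuous.
Qed.

Lemma norm_expi (t : R) : `|expi t| = 1.
Proof. by rewrite normc_def /= cos2Dsin2 sqrtr1. Qed.

Lemma fourier_translate phi k a : schwartz phi ->
  fourier (fun y => phi (y + a)) k = expi (dotv k a) * fourier phi k.
Proof.
move=> sphi; have [[[cRe _] [cIm _]] _] := sphi [::].
have [M phiM] := schwartz_decay sphi.
have cdot : continuous (fun x => - dotv k x).
  by move=> x; apply: continuousN; exact: continuous_dotv.
have ccos : continuous (fun x => cos (- dotv k x)).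
  by move=> x; apply: (continuous_comp (cdot x)); exact: continuous_cos.
have csin : continuous (fun x => sin (- dotv k x)).
  by move=> x; apply: (continuous_comp (cdot x)); exact: continuous_sin.
have cM (f g : 'rV[R]_n -> R) : continuous f -> continuous g ->
    continuous (fun x => f x * g x).
  by move=> cf cg x; apply: continuousM; [exact: cf|exact: cg].
have cD (f g : 'rV[R]_n -> R) : continuous f -> continuous g ->
    continuous (fun x => f x + g x).
  by move=> cf cg x; apply: (@continuousD _ _ _ f g); [exact: cf|exact: cg].
have cB (f g : 'rV[R]_n -> R) : continuous f -> continuous g ->
    continuous (fun x => f x - g x).
  by move=> cf cg x; apply: (@continuousB _ _ _ f g); [exact: cf|exact: cg].
(* The phase e^{ik.a} is taken under the integral on the right, where x + a then replaces x. The
   bound [M] for [phi] serves for the integrand as well, since exponentials have modulus 1. *)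
rewrite /fourier -(@Cintegral_scale_decay _ _ _ _ M).
- rewrite -[RHS](Cintegral_translate _ a); congr Cintegral.
  apply/funext => x; rewrite mulrA -expiD; congr (expi _ * _).
  by rewrite dotvDr; ring.
- rewrite (_ : (fun x => _) = (fun x => cos (- dotv k x) * complex.Re (phi x) -
      sin (- dotv k x) * complex.Im (phi x))); last first.
    by apply/funext => x; case: (phi x).
  exact: cB (cM _ _ ccos cRe) (cM _ _ csin cIm).
- rewrite (_ : (fun x => _) = (fun x => cos (- dotv k x) * complex.Im (phi x) +
      sin (- dotv k x) * complex.Re (phi x))); last first.
    by apply/funext => x; case: (phi x).
  exact: cD (cM _ _ ccos cIm) (cM _ _ csin cRe).
- by move=> x; rewrite normrM norm_expi mul1r.
Qed.

End fourier_translation.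

(** * Translations and twisted boosts of the Wigner function *)

Theorem mainTheorem7 (R : realType) (n : nat) (hbar : R) (theta : 'M[R]_n)
    (phi : 'rV[R]_n -> R[i]) :
  (1 <= n)%N -> 0 < hbar -> theta^T = - theta -> schwartz phi ->
  (forall a x p : 'rV[R]_n,
     ncwigner hbar theta (fun y => phi (y + a)) x p =
     ncwigner hbar theta phi (x + a) p) /\
  (forall p' x p : 'rV[R]_n,
     ncwigner_integral hbar theta
       (twisted_galilean hbar theta p' (wigner_amplitude phi)) x p =
     ncwigner hbar theta phi x (p - p')).
Proof.
move=> _ hbar_gt0 thetaT sphi; split=> [a x p|p' x p].
- apply: eq_Cintegral => w; apply: (congr1 ( *%R _)).
  apply: eq_Cintegral => k; apply: (congr1 ( *%R _)).
  apply: eq_Cintegral => k'; apply: (congr1 ( *%R _)).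
  (* The integrands agree pointwise: the two Fourier transforms yield e^{ik.a} and the conjugate of
     e^{ik'.a}, the phases absorbed by moving x to x + a. *)
  rewrite -moyal_expi_shift /wigner_amplitude !fourier_translate// rmorphM.
  by move: (moyal _ _ _ _) => m; ring.
- pose q := hbar^-1 *: p'.
  apply: eq_Cintegral => w; apply: (congr1 ( *%R _)).
  (* First k is shifted by [q] at fixed w, then k' at fixed w and k. In the boosted amplitude the
     arguments k + q - q and k' + q - q then collapse to k and k'. *)
  rewrite -[LHS](Cintegral_translate _ q).
  apply: eq_Cintegral => k; apply: (congr1 ( *%R _)).
  rewrite -[LHS](Cintegral_translate _ q).
  apply: eq_Cintegral => k'; apply: (congr1 ( *%R _)).
  have := moyal_expi_boost k k' p' p x w (lt0r_neq0 hbar_gt0) thetaT.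
  rewrite /= -/q => boost.
  rewrite [RHS]mulrAC -boost /twisted_galilean -/q !addrK.
  move: (moyal _ _ _ _) (wigner_amplitude _ _ _) => m A.
  by ring.
Qed.
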